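(* Let $\Gamma$ be a finite group, let $P$ be a finite poset with a left $\Gamma$-action (by order automorphisms), and let $T$ be a graph with a right $\Gamma$-action (by graph automorphisms). Then for any graph $G$ there is a natural homotopy equivalence \[\mathrm{Poset}_{\Gamma}\bigl(P, \mathrm{Hom}(T,G)\bigr) \simeq \mathrm{Hom}\bigl(T \times_{\Gamma} P^1, G\bigr).\]
   Context: Graphs are finite, undirected, without multiple edges, loops allowed: a graph $G$ is a finite set $V(G)$ with a symmetric relation $E(G)\subseteq V(G)\times V(G)$; write $u\sim v$ for $(u,v)\in E(G)$. A graph homomorphism $G\to H$ is a map $V(G)\to V(H)$ preserving adjacency. The product $G\times H$ has vertex set $V(G)\times V(H)$ with $(g,h)\sim(g',h')$ iff $g\sim g'$ and $h\sim h'$. $\mathrm{Hom}(T,G)$ is the poset of all maps $\alpha\colon V(T)\to 2^{V(G)}\setminus\{\emptyset\}$ such that whenever $t\sim t'$ in $T$, every element of $\alpha(t)$ is adjacent to every element of $\alpha(t')$; ordered by $\alpha\le\beta$ iff $\alpha(t)\subseteq\beta(t)$ for all $t$. The right $\Gamma$-action on $T$ induces a left $\Gamma$-action on $\mathrm{Hom}(T,G)$ by $(\gamma\cdot\alpha)(t)=\alpha(t\cdot\gamma)$. For a poset $P$, $P^1$ is the reflexive graph (every vertex looped) whose vertices are the atoms (minimal elements) of $P$, with $x\sim y$ iff there is $z\in P$ with $z\ge x$ and $z\ge y$; a $\Gamma$-action on $P$ induces one on $P^1$. If $T$ has a right and $H$ a left $\Gamma$-action, $T\times_\Gamma H$ is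 the graph whose vertices are the equivalence classes of $V(T)\times V(H)$ under $(t\gamma,h)\sim(t,\gamma h)$, with $[(t,h)]\sim[(t',h')]$ iff some representatives are adjacent in $T\times H$. $\mathrm{Poset}_\Gamma(P,Q)$ is the poset of all $\Gamma$-equivariant order-preserving maps $P\to Q$, ordered by $f\le g$ iff $f(x)\le g(x)$ for all $x$. For posets $P,Q$, ''$P\simeq Q$'' means there is a homotopy equivalence between the geometric realizations of their order complexes $|P|\to|Q|$ such that it and a homotopy inverse are both induced by order-preserving maps. *)

(* Defs.v *)
From HB Require Import structures.
From mathcomp Require Import all_boot all_order all_fingroup.
From mathcomp Require Import generic_quotient.

Set Implicit Arguments.
Unset Strict Implicit.
Unset Printing Implicit Defensive.

Import Order.TTheory.

Local Open Scope order_scope.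
Local Open Scope group_scope.
Local Open Scope quotient_scope.

Record graph : Type := Graph {
  vertex :> finType;
  adj : rel vertex;
  adj_sym : symmetric adj
}.

Record graph_hom (G H : graph) : Type := GraphHom {
  graph_hom_fun :> G -> H;
  graph_homP : forall x y, adj x y -> adj (graph_hom_fun x) (graph_hom_fun y)
}.

Section GraphProduct.
Variables T H : graph.

Definition gprod_adj : rel (T * H) :=
  fun u v => adj u.1 v.1 && adj u.2 v.2.

Lemma gprod_adj_sym : symmetric gprod_adj.
Proof. by move=> u v; rewrite /gprod_adj adj_sym (adj_sym u.2). Qed.

Definition gprod : graph := Graph gprod_adj_sym.

End GraphProduct.

(** MathComp's [{action gT &-> _}] are right actions, so left actions are
    spelled out. *)

Record right_graph (gT : finGroupType) : Type := RGraph {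
  rgraph_graph :> graph;
  ract : {action gT &-> rgraph_graph};
  ract_adj : forall g t t', adj (ract t g) (ract t' g) = adj t t'
}.

Record left_graph (gT : finGroupType) : Type := LGraph {
  lgraph_graph :> graph;
  lgact : gT -> lgraph_graph -> lgraph_graph;
  lgact1 : forall x, lgact 1 x = x;
  lgactM : forall g h x, lgact (g * h) x = lgact g (lgact h x);
  lgact_adj : forall g x y, adj (lgact g x) (lgact g y) = adj x y
}.

Record left_poset (gT : finGroupType) : Type := LPoset {
  lposet_disp : Order.disp_t;
  lposet_poset :> finPOrderType lposet_disp;
  lact : gT -> lposet_poset -> lposet_poset;
  lact1 : forall x, lact 1 x = x;
  lactM : forall g h x, lact (g * h) x = lact g (lact h x);
  lact_le : forall g x y, (lact g x <= lact g y) = (x <= y)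
}.

Record right_graph_hom (gT : finGroupType) (T U : right_graph gT) : Type := RGraphHom {
  rgraph_hom_hom :> graph_hom T U;
  rgraph_homP : forall g t,
    rgraph_hom_hom (ract T t g) = ract U (rgraph_hom_hom t) g
}.

Record left_graph_hom (gT : finGroupType) (H K : left_graph gT) : Type := LGraphHom {
  lgraph_hom_hom :> graph_hom H K;
  lgraph_homP : forall g x,
    lgraph_hom_hom (lgact g x) = lgact g (lgraph_hom_hom x)
}.

Fact hom_display : Order.disp_t. Proof. exact: Order.Disp tt tt. Qed.

Section HomComplex.
Variables T G : graph.

Definition is_multihom (a : {ffun T -> {set G}}) : bool :=
  [forall t, a t != set0] &&
  [forall t, forall t', adj t t' ==>
     [forall x in a t, forall y in a t', adj x y]].

Record hom_complex : Type := Hom {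
  hom_val :> {ffun T -> {set G}};
  hom_valP : is_multihom hom_val
}.

HB.instance Definition _ := [isSub for hom_val].
HB.instance Definition _ := [Finite of hom_complex by <:].

Definition hom_le : rel hom_complex := fun a b => [forall t, a t \subset b t].

Lemma hom_le_refl : reflexive hom_le.
Proof. by move=> a; apply/forallP. Qed.

Lemma hom_le_anti : antisymmetric hom_le.
Proof.
move=> a b /andP[/forallP ab /forallP ba]; apply/val_inj/ffunP => t.
by apply/eqP; rewrite eqEsubset ab ba.
Qed.

Lemma hom_le_trans : transitive hom_le.
Proof.
move=> b a c /forallP ab /forallP bc; apply/forallP => t.
exact: subset_trans (ab t) (bc t).
Qed.

HB.instance Definition _ := Order.Le_isPOrder.Build hom_display hom_complex
  hom_le_refl hom_le_anti hom_le_trans.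

Lemma hom_neq0 (a : hom_complex) t : a t != set0.
Proof. by have /andP[/forallP] := hom_valP a. Qed.

Lemma hom_adj (a : hom_complex) t t' x y :
  adj t t' -> x \in a t -> y \in a t' -> adj x y.
Proof.
have /andP[_ /forallP /(_ t) /forallP /(_ t') /implyP aP] := hom_valP a.
by move=> /aP /forall_inP xP /xP /forall_inP; apply.
Qed.

Lemma hom_leP (a b : hom_complex) : reflect (forall t, a t \subset b t) (a <= b).
Proof. exact: forallP. Qed.

End HomComplex.

Section HomFunctor.
Variables (T T' G G' : graph) (k : graph_hom T' T) (h : graph_hom G G').

Definition hom_map_val (a : hom_complex T G) : {ffun T' -> {set G'}} :=
  [ffun t => h @: a (k t)].

Lemma hom_map_subproof (a : hom_complex T G) : is_multihom (hom_map_val a).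
Proof.
rewrite /hom_map_val; apply/andP; split.
  by apply/forallP => t; rewrite /= ffunE imset_eq0 hom_neq0.
apply/forallP => t; apply/forallP => t'; apply/implyP => tt'.
apply/forall_inP => _ /[!ffunE]/imsetP[x xa ->].
apply/forall_inP => _ /imsetP[y ya ->].
exact/graph_homP/(hom_adj _ xa ya)/graph_homP.
Qed.

Definition hom_map (a : hom_complex T G) : hom_complex T' G' := Hom (hom_map_subproof a).

Lemma hom_map_le : {homo hom_map : a b / a <= b}.
Proof.
move=> a b /hom_leP ab; apply/hom_leP => t.
by rewrite /= !ffunE imsetS.
Qed.

HB.instance Definition _ := Order.isOrderMorphism.Build
  _ (hom_complex T G) _ (hom_complex T' G') hom_map hom_map_le.

End HomFunctor.

Section HomAction.
Variables (gT : finGroupType) (T : right_graph gT) (G : graph).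

Definition hom_act_val (g : gT) (a : hom_complex T G) : {ffun T -> {set G}} :=
  [ffun t => a (ract T t g)].

Lemma hom_act_subproof g a : is_multihom (hom_act_val g a).
Proof.
rewrite /hom_act_val; apply/andP; split.
  by apply/forallP => t; rewrite /= ffunE hom_neq0.
apply/forallP => t; apply/forallP => t'; apply/implyP => tt'.
apply/forall_inP => x /[!ffunE] xa; apply/forall_inP => y ya.
by apply: hom_adj xa ya; rewrite ract_adj.
Qed.

Definition hom_act g a : hom_complex T G := Hom (hom_act_subproof g a).

Lemma hom_act1 a : hom_act 1 a = a.
Proof. by apply/val_inj/ffunP => t; rewrite /= ffunE act1. Qed.

Lemma hom_actM g h a : hom_act (g * h) a = hom_act g (hom_act h a).
Proof. by apply/val_inj/ffunP => t; rewrite /= !ffunE actM. Qed.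

Lemma hom_act_le g a b : (hom_act g a <= hom_act g b) = (a <= b).
Proof.
apply/hom_leP/hom_leP => ab t; last by rewrite /= !ffunE.
by have := ab (ract T t g^-1); rewrite /= !ffunE actKV.
Qed.

Definition hom_lposet : left_poset gT := LPoset hom_act1 hom_actM hom_act_le.

End HomAction.

Section Skeleton.
Variables (gT : finGroupType) (P : left_poset gT).

Definition is_atom (x : P) : bool := [forall y : P, (y <= x) ==> (y == x)].

Lemma is_atomP (x : P) : reflect (forall y, y <= x -> y = x) (is_atom x).
Proof.
apply: (iffP forallP) => xP y.
  by move=> yx; apply/eqP; apply: (implyP (xP y)).
by apply/implyP => /xP ->.
Qed.

Record atom : Type := Atom { atom_val :> P; atomP : is_atom atom_val }.

HB.instance Definition _ := [isSub for atom_val].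
HB.instance Definition _ := [Finite of atom by <:].

Definition skel_adj : rel atom :=
  fun x y => [exists z : P, (atom_val x <= z) && (atom_val y <= z)].

Lemma skel_adj_sym : symmetric skel_adj.
Proof.
by move=> x y; apply/existsP/existsP => -[z]; rewrite andbC; exists z.
Qed.

Lemma lactK g : cancel (@lact gT P g) (@lact gT P g^-1).
Proof. by move=> x; rewrite -lactM mulVg lact1. Qed.

Lemma lactKV g : cancel (@lact gT P g^-1) (@lact gT P g).
Proof. by move=> x; rewrite -lactM mulgV lact1. Qed.

Lemma atom_act_subproof g (x : atom) : is_atom (lact g x).
Proof.
apply/is_atomP => y; rewrite -[y](lactKV g) lact_le => yx.
by congr (lact g _); exact: (is_atomP _ (atomP x)).
Qed.

Definition atom_act g (x : atom) : atom := Atom (atom_act_subproof g x).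

Definition skel_graph : graph := Graph skel_adj_sym.

Lemma skel_act1 x : atom_act 1 x = x.
Proof. by apply: val_inj; rewrite /= lact1. Qed.

Lemma skel_actM g h x : atom_act (g * h) x = atom_act g (atom_act h x).
Proof. by apply: val_inj; rewrite /= lactM. Qed.

Lemma skel_act_adj g x y :
  skel_adj (atom_act g x) (atom_act g y) = skel_adj x y.
Proof.
apply/existsP/existsP => -[z /andP[xz yz]].
  exists (lact g^-1 z).
  by rewrite -(lact_le g) -(lact_le g (atom_val y)) !lactKV xz yz.
by exists (lact g z); rewrite /= !lact_le xz yz.
Qed.

Definition skel : left_graph gT :=
  @LGraph gT skel_graph atom_act skel_act1 skel_actM skel_act_adj.

Lemma skel_refl (x : skel) : adj x x.
Proof. by apply/existsP; exists (atom_val x); rewrite lexx. Qed.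

End Skeleton.

(** Equivariant order-preserving maps sending atoms to atoms: the maps of
    posets on which P |-> P^1 is functorial. *)
Record left_poset_hom (gT : finGroupType) (P Q : left_poset gT) : Type := LPosetHom {
  lposet_hom_fun :> P -> Q;
  lposet_hom_le : {homo lposet_hom_fun : x y / x <= y};
  lposet_homP : forall g x, lposet_hom_fun (lact g x) = lact g (lposet_hom_fun x);
  lposet_hom_atom : forall x, is_atom x -> is_atom (lposet_hom_fun x)
}.

Section SkeletonFunctor.
Variables (gT : finGroupType) (P Q : left_poset gT) (f : left_poset_hom P Q).

Definition skel_map_fun (x : skel P) : skel Q :=
  Atom (lposet_hom_atom f (atomP x)).

Lemma skel_map_adj x y : adj x y -> adj (skel_map_fun x) (skel_map_fun y).
Proof.
move=> /existsP[z /andP[xz yz]]; apply/existsP; exists (f z).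
by rewrite /= !lposet_hom_le.
Qed.

Lemma skel_map_act g x : skel_map_fun (lgact g x) = lgact g (skel_map_fun x).
Proof. by apply: val_inj; rewrite /= lposet_homP. Qed.

Definition skel_map : left_graph_hom (skel P) (skel Q) :=
  @LGraphHom gT (skel P) (skel Q) (GraphHom skel_map_adj) skel_map_act.

End SkeletonFunctor.

Section BalancedProduct.
Variables (gT : finGroupType) (T : right_graph gT) (H : left_graph gT).

(** [u] and [v] are related iff [u = (t g, h)] and [v = (t, g h)] for some
    [g], [t], [h]; this is already an equivalence relation. *)
Definition bal_rel : rel (gprod T H) := fun u v =>
  [exists g : gT, (u.1 == ract T v.1 g) && (v.2 == lgact g u.2)].

Lemma bal_rel_refl : reflexive bal_rel.
Proof. by move=> u; apply/existsP; exists 1; rewrite act1 lgact1 !eqxx. Qed.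

Lemma bal_rel_sym : symmetric bal_rel.
Proof.
have sub u v : bal_rel u v -> bal_rel v u.
  move=> /existsP[g /andP[/eqP e1 /eqP e2]]; apply/existsP; exists g^-1.
  by rewrite e1 e2 actK -lgactM mulVg lgact1 !eqxx.
by move=> u v; apply/idP/idP => /sub.
Qed.

Lemma bal_rel_trans : transitive bal_rel.
Proof.
move=> v u w /existsP[g /andP[/eqP u1 /eqP v2]].
move=> /existsP[h /andP[/eqP v1 /eqP w2]]; apply/existsP; exists (h * g).
by rewrite u1 v1 w2 v2 actM lgactM !eqxx.
Qed.

Canonical bal_equiv := EquivRel bal_rel bal_rel_refl bal_rel_sym bal_rel_trans.

Definition bal_vertex := {eq_quot bal_equiv}.

HB.instance Definition _ := Choice.on bal_vertex.
HB.instance Definition _ := EqQuotient.on bal_vertex.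
HB.instance Definition _ : isCountable bal_vertex :=
  CanIsCountable (@reprK _ bal_vertex).
HB.instance Definition _ : isFinite bal_vertex :=
  CanIsFinite (@reprK _ bal_vertex).

Definition bal_adj : rel bal_vertex := fun A B =>
  [exists u : gprod T H, exists v : gprod T H,
    [&& \pi_bal_vertex u == A, \pi_bal_vertex v == B & adj u v]].

Lemma bal_adj_sym : symmetric bal_adj.
Proof.
have sub A B : bal_adj A B -> bal_adj B A.
  move=> /existsP[u /existsP[v /and3P[uA vB uv]]].
  by apply/existsP; exists v; apply/existsP; exists u; rewrite uA vB adj_sym.
by move=> A B; apply/idP/idP => /sub.
Qed.

Definition balprod : graph := Graph bal_adj_sym.

Definition bal_class (u : gprod T H) : balprod := \pi_bal_vertex u.

Lemma bal_classP u v : reflect (bal_class u = bal_class v) (bal_rel u v).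
Proof. exact: eqmodP. Qed.

Lemma bal_class_act t g h : bal_class (ract T t g, h) = bal_class (t, lgact g h).
Proof. by apply/bal_classP/existsP; exists g; rewrite !eqxx. Qed.

Lemma bal_adjP (A B : balprod) :
  reflect (exists u v, [/\ bal_class u = A, bal_class v = B & adj u v]) (adj A B).
Proof.
apply: (iffP existsP) => [[u /existsP[v /and3P[/eqP uA /eqP vB uv]]]|].
  by exists u, v.
move=> [u [v [uA vB uv]]]; exists u; apply/existsP; exists v.
by apply/and3P; split=> //; apply/eqP.
Qed.

End BalancedProduct.

Section BalancedProductFunctor.
Variables (gT : finGroupType) (T U : right_graph gT) (H K : left_graph gT).
Variables (k : right_graph_hom T U) (l : left_graph_hom H K).

Definition bal_map_fun (A : balprod T H) : balprod U K :=
  let u := repr (A : bal_vertex T H) in bal_class (k u.1, l u.2).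

Lemma bal_map_class (u : gprod T H) :
  bal_map_fun (bal_class u) = bal_class (k u.1, l u.2).
Proof.
apply/bal_classP/existsP.
have /bal_classP/existsP[g /andP[/eqP e1 /eqP e2]] :
  bal_class (repr (bal_class u : bal_vertex T H)) = bal_class u by exact: reprK.
by exists g; rewrite /= e1 e2 rgraph_homP lgraph_homP !eqxx.
Qed.

Lemma bal_map_adj A B : adj A B -> adj (bal_map_fun A) (bal_map_fun B).
Proof.
move=> /bal_adjP[u [v [<- <- /andP[uv1 uv2]]]]; rewrite !bal_map_class.
apply/bal_adjP; exists (k u.1, l u.2), (k v.1, l v.2); split=> //.
by apply/andP; split; apply: graph_homP.
Qed.

Definition bal_map : graph_hom (balprod T H) (balprod U K) :=
  GraphHom bal_map_adj.

End BalancedProductFunctor.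

Fact eqposet_display : Order.disp_t. Proof. exact: Order.Disp tt tt. Qed.

Section EquivariantMaps.
Variables (gT : finGroupType) (P Q : left_poset gT).

Definition is_eqposet (f : {ffun P -> Q}) : bool :=
  [forall x : P, forall y : P, (x <= y) ==> (f x <= f y)] &&
  [forall g : gT, forall x : P, f (lact g x) == lact g (f x)].

Record eqposet : Type := EqPoset {
  eqposet_val :> {ffun P -> Q};
  eqposet_valP : is_eqposet eqposet_val
}.

HB.instance Definition _ := [isSub for eqposet_val].
HB.instance Definition _ := [Finite of eqposet by <:].

Definition eqposet_rel : rel eqposet := fun f g => [forall x : P, f x <= g x].

Lemma eqposet_rel_refl : reflexive eqposet_rel.
Proof. by move=> f; apply/forallP => x. Qed.

Lemma eqposet_rel_anti : antisymmetric eqposet_rel.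
Proof.
move=> f g /andP[/forallP fg /forallP gf]; apply/val_inj/ffunP => x.
by apply: le_anti; rewrite fg gf.
Qed.

Lemma eqposet_rel_trans : transitive eqposet_rel.
Proof.
move=> g f h /forallP fg /forallP gh; apply/forallP => x.
exact: le_trans (fg x) (gh x).
Qed.

HB.instance Definition _ := Order.Le_isPOrder.Build eqposet_display eqposet
  eqposet_rel_refl eqposet_rel_anti eqposet_rel_trans.

Lemma eqposetP (f : {ffun P -> Q}) :
  reflect ({homo f : x y / x <= y} /\
           forall g x, f (lact g x) = lact g (f x)) (is_eqposet f).
Proof.
apply: (iffP andP) => -[fle fact]; split.
- by move=> x y; have /forallP/(_ x)/forallP/(_ y)/implyP := fle.
- by move=> g x; have /forallP/(_ g)/forallP/(_ x)/eqP := fact.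
- by do 2![apply/forallP => ?]; apply/implyP; apply: fle.
- by do 2![apply/forallP => ?]; apply/eqP.
Qed.

Lemma eqposet_leP (f g : eqposet) : reflect (forall x, f x <= g x) (f <= g).
Proof. exact: forallP. Qed.

End EquivariantMaps.

Section EquivariantMapsFunctor.
Variables (gT : finGroupType) (P P' : left_poset gT) (T T' : right_graph gT).
Variables (G G' : graph).
Variables (a : left_poset_hom P' P) (k : right_graph_hom T' T) (h : graph_hom G G').

Definition eqposet_map_val (f : eqposet P (hom_lposet T G)) :
    {ffun P' -> hom_lposet T' G'} :=
  [ffun x => hom_map k h (f (a x))].

Lemma eqposet_map_subproof f : is_eqposet (eqposet_map_val f).
Proof.
have /eqposetP[fle fact] := eqposet_valP f; apply/eqposetP; split.
  by move=> x y xy; rewrite /= !ffunE; apply/hom_map_le/fle/lposet_hom_le.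
move=> g x; rewrite /= !ffunE lposet_homP fact; apply/val_inj/ffunP => t.
by rewrite /= !ffunE rgraph_homP.
Qed.

Definition eqposet_map (f : eqposet P (hom_lposet T G)) :
  eqposet P' (hom_lposet T' G') := EqPoset (eqposet_map_subproof f).

End EquivariantMapsFunctor.

(** Imported only here: [classical_sets] shadows the notations of [finset]. *)
From mathcomp Require Import all_algebra.
From mathcomp Require Import all_classical all_reals all_analysis.
Import GRing.Theory Num.Theory numFieldNormedType.Exports.

Local Open Scope classical_set_scope.
Local Open Scope ring_scope.

(** Geometric realization of the order complex: barycentric coordinates,
    i.e. probability weights on [P] whose support is a chain. *)
Definition realization (R : realType) d (P : finPOrderType d) :
    set {ptws P -> R} :=
  [set w | [/\ forall p, 0 <= w p, \sum_p w p = 1 &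
               forall p q, w p != 0 -> w q != 0 -> (p >=< q)%O]].
Arguments realization R {d} P.

Section RealizationFunctor.
Variables (R : realType) (d d' : Order.disp_t).
Variables (P : finPOrderType d) (Q : finPOrderType d').
Variable f : {omorphism P -> Q}.

Definition push_weight (w : {ptws P -> R}) : {ptws Q -> R} :=
  fun q => \sum_(p | f p == q) w p.

Lemma push_weight_realization w :
  realization R P w -> realization R Q (push_weight w).
Proof.
move=> [w0 w1 wc]; split.
- by move=> q; apply: sumr_ge0.
- by rewrite -w1 (partition_big f xpredT).
- have supp q : push_weight w q != 0 -> exists2 p, w p != 0 & f p = q.
    move=> wq; have [|nw] := pselect (exists2 p, w p != 0 & f p = q) => //.
    case/eqP: wq; apply: big1 => p /eqP fp; apply/eqP.
    by apply: contra_notT nw => wp; exists p.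
  move=> _ _ /supp[p wp <-] /supp[q wq <-].
  by case/orP: (wc _ _ wp wq) => /(omorph_le f) pq;
    rewrite /Order.comparable pq ?orbT.
Qed.

Definition realization_map (w : realization R P) : realization R Q :=
  exist _ (push_weight (\val w)) (mem_set (push_weight_realization (set_valP w))).

End RealizationFunctor.

Arguments realization_map R {d d' P Q} f w.

Definition homotopic (R : realType) (X Y : topologicalType) (f g : X -> Y) :
    Prop :=
  exists H : X * R -> Y,
    [/\ {within [set: X] `*` `[0, 1], continuous H},
        forall x, H (x, 0) = f x & forall x, H (x, 1) = g x].

Definition homotopy_inverses (R : realType) (X Y : topologicalType)
    (f : X -> Y) (g : Y -> X) : Prop :=
  [/\ continuous f, continuous g,
      homotopic R (g \o f) idfun & homotopic R (f \o g) idfun].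

Definition poset_homotopy_equiv (R : realType) d d' (P : finPOrderType d)
    (Q : finPOrderType d') (f : {omorphism P -> Q}) : Prop :=
  exists g : {omorphism Q -> P},
    homotopy_inverses R (realization_map R f) (realization_map R g).

(* Main.v *)
(** An equivariant map f is sent to [(t, x)] |-> f x t for x an atom, and b is
    sent back to (p, t) |-> the union of the b [(t, x)] over the atoms x <= p.
    Going to the right-hand poset and back there decreases f, and the other
    composite is the identity. Two comparable order-preserving maps have
    homotopic realizations, through the prism decomposition of |P| x [0, 1]
    written in barycentric coordinates. *)

Require Import Defs.
From HB Require Import structures.
From mathcomp Require Import all_boot all_order all_fingroup.
From mathcomp Require Import generic_quotient.

Set Implicit Arguments.
Unset Strict Implicit.
Unset Printing Implicit Defensive.

Import Order.TTheory.

Local Open Scope order_scope.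

(** * Atoms of a finite poset and classes of the balanced product *)

Lemma atom_below (gT : finGroupType) (P : left_poset gT) (p : P) :
  exists x : skel P, atom_val x <= p.
Proof.
have [n] := ubnP #|[set y : P | y <= p]|; elim: n p => // n IHn p ltn.
have [pA | ] := boolP (is_atom p); first by exists (Atom pA).
rewrite negb_forall => /existsP[q]; rewrite negb_imply => /andP[qp neq_qp].
have [|x xq] := IHn q; last by exists x; apply: le_trans qp.
(* The down-set of [q] lies in that of [p] and misses [p] itself, so the induction measure drops. *)
apply: leq_trans (ltn : (_ <= n)%N); apply/proper_card/properP; split.
  by apply/subsetP => y; rewrite !inE => /le_trans; apply.
exists p; rewrite !inE //; apply: contra neq_qp => pq.
by apply/eqP/le_anti; rewrite qp.
Qed.

Lemma bal_class_repr (gT : finGroupType) (T : right_graph gT) (H : left_graph gT)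
    (A : balprod T H) :
  bal_class (repr (A : bal_vertex T H)) = A.
Proof. exact: reprK. Qed.

Lemma bal_class_surj (gT : finGroupType) (T : right_graph gT) (H : left_graph gT)
    (A : balprod T H) :
  exists t x, A = bal_class (t, x).
Proof. by rewrite -(bal_class_repr A); case: repr => t x; exists t, x. Qed.

(** * The two order-preserving maps between the posets *)

Section Comparison.
Variables (gT : finGroupType) (P : left_poset gT) (T : right_graph gT) (G : graph).

Section ToHom.
Variable f : eqposet P (hom_lposet T G).

Let f_le x y : x <= y -> f x <= f y.
Proof. by have /eqposetP[fle _] := eqposet_valP f; exact: fle. Qed.

Let f_act g x t : f (lact g x) t = f x (Defs.ract T t g).
Proof. by have /eqposetP[_ ->] := eqposet_valP f; rewrite /= ffunE. Qed.

Definition to_hom_val : {ffun balprod T (skel P) -> {set G}} :=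
  [ffun A => let u := repr (A : bal_vertex T (skel P)) in f (atom_val u.2) u.1].

(** Independence of the chosen representative: two representatives differ by moving some [g] across
    the pair, and equivariance of [f] absorbs this [g]. *)
Lemma to_hom_val_class t (x : skel P) :
  to_hom_val (bal_class (t, x)) = f (atom_val x) t.
Proof.
rewrite ffunE /=; set u : gprod T (skel P) := repr _.
have /bal_classP/existsP[g /andP[/eqP ut /eqP /= ->]] :
  bal_class u = bal_class (t, x) by exact: bal_class_repr.
by rewrite ut f_act.
Qed.

Lemma to_hom_subproof : is_multihom to_hom_val.
Proof.
apply/andP; split.
  by apply/forallP => A; have [t [x ->]] := bal_class_surj A; rewrite to_hom_val_class hom_neq0.
apply/forallP => A; apply/forallP => B.
apply/implyP => /bal_adjP[[t x] [[t' x'] [<- <- /andP[/= tt' /existsP[z]]]]].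
(* Adjacent atoms have a common upper bound [z]; both values sit inside those of the single
   multihomomorphism [f z], where adjacency over [t], [t'] is known. *)
move=> /andP[/f_le/hom_leP xz /f_le/hom_leP x'z]; rewrite !to_hom_val_class.
apply/forall_inP => a /(subsetP (xz t)) az; apply/forall_inP => b /(subsetP (x'z t')).
exact: hom_adj tt' az.
Qed.

Definition to_hom : hom_complex (balprod T (skel P)) G := Hom to_hom_subproof.

Lemma to_hom_class t (x : skel P) : to_hom (bal_class (t, x)) = f (atom_val x) t.
Proof. exact: to_hom_val_class. Qed.

End ToHom.

Lemma hom_balprod_le (b c : hom_complex (balprod T (skel P)) G) :
  (forall t x, b (bal_class (t, x)) \subset c (bal_class (t, x))) -> b <= c.
Proof.
move=> bc; apply/hom_leP => A.
by have [t [x ->]] := bal_class_surj A.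
Qed.

Lemma to_hom_le : {homo to_hom : f g / f <= g}.
Proof.
move=> f g /eqposet_leP fg; apply: hom_balprod_le => t x.
by rewrite !to_hom_class; apply/hom_leP.
Qed.

HB.instance Definition _ := Order.isOrderMorphism.Build
  _ (eqposet P (hom_lposet T G)) _ (hom_complex (balprod T (skel P)) G)
  to_hom to_hom_le.

Section OfHom.
Variable b : hom_complex (balprod T (skel P)) G.

Definition of_hom_at_val (p : P) : {ffun T -> {set G}} :=
  [ffun t => \bigcup_(x : skel P | atom_val x <= p) b (bal_class (t, x))].

(** The union is nonempty because some atom lies below [p]; any two atoms below [p] are adjacent in
    the skeleton, with [p] itself as the common upper bound. *)
Lemma of_hom_at_subproof p : is_multihom (of_hom_at_val p).
Proof.
apply/andP; split; apply/forallP => t.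
  have [x xp] := atom_below p; have [a ab] := set0Pn _ (hom_neq0 b (bal_class (t, x))).
  by apply/set0Pn; exists a; rewrite ffunE; apply/bigcupP; exists x.
apply/forallP => t'; apply/implyP => tt'; apply/forall_inP => a.
rewrite ffunE => /bigcupP[x xp ax]; apply/forall_inP => c.
rewrite ffunE => /bigcupP[y yp cy]; apply: hom_adj ax cy.
apply/bal_adjP; exists (t, x), (t', y); split=> //.
by apply/andP; split=> //; apply/existsP; exists p; rewrite xp.
Qed.

Definition of_hom_at p : hom_complex T G := Hom (of_hom_at_subproof p).

Lemma of_hom_subproof :
  is_eqposet ([ffun p => of_hom_at p] : {ffun P -> hom_lposet T G}).
Proof.
apply/eqposetP; split=> [p q pq | g p]; rewrite !ffunE.
  apply/hom_leP => t; rewrite /= !ffunE.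
  apply/bigcupsP => x xp; apply: (bigcup_sup x) => //; exact: le_trans pq.
apply/val_inj/ffunP => t; rewrite /= !ffunE.
(* Translation by [g] carries the atoms below [p] onto those below [lact g p]; the [g] then crosses
   to the [T] side of the class. *)
rewrite (reindex_inj (can_inj (_ : cancel (@atom_act _ P g) (atom_act g^-1)))) /=.
  by apply: eq_big => x; rewrite ?lact_le // bal_class_act.
by move=> x; rewrite -skel_actM mulVg skel_act1.
Qed.

Definition of_hom : eqposet P (hom_lposet T G) := EqPoset of_hom_subproof.

Lemma of_homE p t :
  of_hom p t = \bigcup_(x : skel P | atom_val x <= p) b (bal_class (t, x)).
Proof. by rewrite /= ffunE /= ffunE. Qed.

End OfHom.

Lemma of_hom_le : {homo of_hom : b c / b <= c}.
Proof.
move=> b c /hom_leP bc; apply/eqposet_leP => p; apply/hom_leP => t.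
rewrite !of_homE; apply/bigcupsP => x xp.
exact: subset_trans (bc _) (bigcup_sup x xp).
Qed.

HB.instance Definition _ := Order.isOrderMorphism.Build
  _ (hom_complex (balprod T (skel P)) G) _ (eqposet P (hom_lposet T G))
  of_hom of_hom_le.

(** The only atom below an atom is itself, so the union defining [of_hom] has a single term
    there. *)
Lemma of_homK : cancel of_hom to_hom.
Proof.
move=> b; apply: le_anti; apply/andP; split; apply: hom_balprod_le => t x.
  rewrite to_hom_class of_homE; apply/bigcupsP => y /(is_atomP _ (atomP x)).
  by move=> /val_inj ->.
by rewrite to_hom_class of_homE; apply: (bigcup_sup x).
Qed.

(** Monotonicity puts [f x] below [f p] for each atom [x] under [p]; [f p] may exceed the union of
    these values, hence only an inequality. *)
Lemma to_homK_le f : of_hom (to_hom f) <= f.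
Proof.
have /eqposetP[f_le _] := eqposet_valP f.
apply/eqposet_leP => p; apply/hom_leP => t; rewrite of_homE.
by apply/bigcupsP => x xp; rewrite to_hom_class; apply/hom_leP/f_le.
Qed.

End Comparison.

(** * Naturality in the poset and both graphs *)

Lemma to_hom_natural (gT : finGroupType) (P P' : left_poset gT)
    (T T' : right_graph gT) (G G' : graph) (a : left_poset_hom P' P)
    (k : right_graph_hom T' T) (h : graph_hom G G')
    (f : eqposet P (hom_lposet T G)) :
  to_hom (eqposet_map a k h f) = hom_map (bal_map k (skel_map a)) h (to_hom f).
Proof.
apply/val_inj/ffunP => A; have [t [x ->]] := bal_class_surj A.
have map_class : bal_map k (skel_map a) (bal_class (t, x)) =
    bal_class (k t, skel_map a x) by exact: bal_map_class.
rewrite [RHS]ffunE map_class [in RHS]to_hom_class [LHS]to_hom_class.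
by rewrite /= ffunE /= ffunE.
Qed.

From mathcomp Require Import all_algebra lra.
From mathcomp Require Import all_classical all_reals all_analysis.

Import GRing.Theory Num.Theory numFieldNormedType.Exports.

Local Open Scope classical_set_scope.
Local Open Scope ring_scope.

(** * Continuity and functoriality of geometric realization *)

Lemma continuous_ptws (X Y : topologicalType) (I : eqType) (f : X -> {ptws I -> Y}) :
  (forall i, continuous (fun x => f x i)) -> continuous f.
Proof.
move=> fc x; apply/cvg_sup => i.
exact: (@continuous_comp_initial _ X Y (@^~ i) f (fc i) x).
Qed.

Section Realization.
Variable R : realType.

Section Weights.
Variables (d : Order.disp_t) (P : finPOrderType d).

Lemma continuous_weight (p : P) :
  continuous (fun w : realization R P => \val w p).
Proof.
move=> w; apply: (@continuous_comp _ _ _ (@set_val _ (realization R P)) (proj p)).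
  exact: initial_continuous.
exact: proj_continuous.
Qed.

Lemma continuous_weight_fst (p : P) :
  continuous (fun z : realization R P * R => \val z.1 p : R^o).
Proof.
move=> z; apply: (@continuous_comp _ _ _ fst (fun w : realization R P => \val w p)).
  exact: cvg_fst.
exact: continuous_weight.
Qed.

Lemma continuous_realization (X : topologicalType) (f : X -> realization R P) :
  (forall p, continuous (fun x => \val (f x) p)) -> continuous f.
Proof.
move=> fc.
apply: (@continuous_comp_initial _ X _ (@set_val _ (realization R P)) f).
exact: continuous_ptws.
Qed.

Lemma realization_ext (u v : realization R P) : \val u =1 \val v -> u = v.
Proof. by move=> uv; apply/val_inj/funext. Qed.

End Weights.

Section Maps.
Variables (d d' d'' : Order.disp_t) (P : finPOrderType d).
Variables (Q : finPOrderType d') (S : finPOrderType d'').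

Lemma realization_map_continuous (f : {omorphism P -> Q}) :
  continuous (realization_map R f).
Proof.
apply: continuous_realization => q /=.
by apply: continuous_big => [|p _]; [exact: add_continuous|exact: continuous_weight].
Qed.

Lemma realization_map_idfun : realization_map R (@idfun P) =1 idfun.
Proof.
move=> w; apply: realization_ext => p; rewrite /= /push_weight.
by rewrite big_pred1_eq.
Qed.

Lemma realization_map_comp (f : {omorphism Q -> S}) (g : {omorphism P -> Q}) :
  realization_map R (f \o g) =1 realization_map R f \o realization_map R g.
Proof.
move=> w; apply: realization_ext => s; rewrite /= /push_weight /=.
rewrite (partition_big g (fun q => f q == s)) //=.
apply: eq_bigr => q /eqP <-; apply: eq_bigl => p.
by rewrite andbC; case: eqP => //= ->; rewrite eqxx.
Qed.

End Maps.

(** * The prism homotopy between comparable order-preserving maps *)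

Section Prism.
Variables (d : Order.disp_t) (P : finPOrderType d).
Implicit Types (w : P -> R) (t : R).

Definition weight_above w p : R := \sum_(q | (p < q)%O) w q.

(* Stack the weights along the support, larger elements below, so that the mass
   at p occupies the interval [s, s + w p] with s := weight_above w p; this is
   the length of the part of that interval lying below level t. *)
Definition submerged w t p : R :=
  Num.min t (weight_above w p + w p) - Num.min t (weight_above w p).

Section Bounds.
Variables (w : P -> R) (t : R).
Hypothesis wR : realization R P w.

Let w_ge0 p : 0 <= w p. Proof. by case: wR. Qed.

Lemma weight_above_ge0 p : 0 <= weight_above w p.
Proof. exact: sumr_ge0. Qed.

Lemma weight_above_le1 p : weight_above w p + w p <= 1.
Proof.
case: wR => _ <- _; rewrite addrC (bigD1 p) //= lerD2l.
rewrite /weight_above big_mkcond [leRHS]big_mkcond ler_sum // => q _.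
by case: ifP => [/gt_eqF ->|_] //; case: ifP.
Qed.

(** By transitivity, [q] and all elements above it count among those above [p]. *)
Lemma weight_above_lt p q : (p < q)%O -> weight_above w q + w q <= weight_above w p.
Proof.
move=> pq; rewrite addrC [leRHS](bigD1 q) //= lerD2l.
rewrite /weight_above big_mkcond [leRHS]big_mkcond ler_sum // => r _.
case: ifP => [qr|_]; last by case: ifP.
by rewrite (lt_trans pq qr) (gt_eqF qr).
Qed.

Lemma submerged_ge0 p : 0 <= submerged w t p.
Proof.
have wp := w_ge0 p; rewrite /submerged.
by case: (leP t) => ?; case: (leP t) => ?; lra.
Qed.

Lemma submerged_le p : submerged w t p <= w p.
Proof.
have wp := w_ge0 p; rewrite /submerged.
by case: (leP t) => ?; case: (leP t) => ?; lra.
Qed.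

Lemma submerged0 p : submerged w 0 p = 0.
Proof.
have wp := w_ge0 p; have sp := weight_above_ge0 p; rewrite /submerged.
by case: (leP 0) => ?; case: (leP 0) => ?; lra.
Qed.

Lemma submerged1 p : submerged w 1 p = w p.
Proof.
have wp := w_ge0 p; have sp := weight_above_le1 p; rewrite /submerged.
by case: (leP 1) => ?; case: (leP 1) => ?; lra.
Qed.

Lemma submerged_neq0 p : submerged w t p != 0 -> w p != 0.
Proof.
move=> up; rewrite gt_eqF // (lt_le_trans _ (submerged_le p)) //.
by rewrite lt_def up submerged_ge0.
Qed.

Lemma emerged_neq0 p : w p - submerged w t p != 0 -> w p != 0.
Proof.
apply: contra_neq => wp; have := submerged_le p; have := submerged_ge0 p.
by rewrite wp; lra.
Qed.

(** Both points lie in the support, a chain. If [q < p], the interval of [p] would end before that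
    of [q] starts, so a level reaching into the latter would submerge all of [p]. *)
Lemma emerged_le_submerged p q :
  w p - submerged w t p != 0 -> submerged w t q != 0 -> (p <= q)%O.
Proof.
move=> ep uq; case: wR => _ _ /(_ p q (emerged_neq0 ep) (submerged_neq0 uq)).
case: comparableP => //  qp _.
have spq := weight_above_lt qp; have wp := w_ge0 p; have wq := w_ge0 q.
move: ep uq => /eqP + /eqP; rewrite /submerged.
by case: (leP t) => ?; case: (leP t) => ?; case: (leP t) => ?; case: (leP t) => ?; lra.
Qed.

End Bounds.

Variables (d' : Order.disp_t) (Q : finPOrderType d') (f g : {omorphism P -> Q}).
Hypothesis le_fg : forall p, (f p <= g p)%O.

(** The emerged mass is pushed along [f] and the submerged mass along [g], so raising [t] from 0 to
    1 trades [f] for [g]. *)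
Definition prism_weight w t : {ptws Q -> R} := fun q =>
  \sum_(p | f p == q) (w p - submerged w t p) + \sum_(p | g p == q) submerged w t p.

Lemma prism_weight_realization w t :
  realization R P w -> realization R Q (prism_weight w t).
Proof.
move=> wR; split.
- move=> q; rewrite addr_ge0 ?sumr_ge0 // => p _; last exact: submerged_ge0.
  by rewrite subr_ge0 submerged_le.
- have sum_fibers (h : P -> Q) (u : P -> R) :
      \sum_q \sum_(p | h p == q) u p = \sum_p u p.
    by rewrite (partition_big h xpredT).
  rewrite big_split /= !sum_fibers -big_split /=.
  by under eq_bigr do rewrite subrK; case: wR.
have supp q : prism_weight w t q != 0 ->
    (exists2 p, w p - submerged w t p != 0 & f p = q) \/
    (exists2 p, submerged w t p != 0 & g p = q).
  apply: contra_neqP => /not_orP[nf ng]; rewrite /prism_weight !big1 ?addr0 //.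
    by move=> p /eqP gp; apply/eqP; apply: contra_notT ng => ?; exists p.
  by move=> p /eqP fp; apply/eqP; apply: contra_notT nf => ?; exists p.
case: (wR) => _ _ wc.
have homo_cmp (h : {omorphism P -> Q}) p p' : (p >=< p')%O -> (h p >=< h p')%O.
  by case/orP => /(omorph_le h) pp'; rewrite /Order.comparable pp' ?orbT.
move=> _ _ /supp[] [p pw <-] /supp[] [p' pw' <-].
- by apply: homo_cmp; apply: wc; exact: (emerged_neq0 (t := t)).
(* Emerged [p] and submerged [p'] satisfy [p <= p'], whence [f p <= g p <= g p']; the next case is
   symmetric. *)
- apply: le_comparable; apply: le_trans (le_fg p) _; apply: omorph_le.
  exact: emerged_le_submerged pw pw'.
- apply: ge_comparable; apply: le_trans (le_fg p') _; apply: omorph_le.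
  exact: emerged_le_submerged pw' pw.
- by apply: homo_cmp; apply: wc; exact: (submerged_neq0 (t := t)).
Qed.

Definition prism (z : realization R P * R) : realization R Q :=
  exist _ (prism_weight (\val z.1) z.2)
    (mem_set (prism_weight_realization z.2 (set_valP z.1))).

Lemma continuous_submerged p :
  continuous (fun z : realization R P * R => submerged (\val z.1) z.2 p).
Proof.
have sc : continuous (fun z : realization R P * R => weight_above (\val z.1) p : R^o).
  apply: continuous_big => [|q _]; first exact: add_continuous.
  exact: continuous_weight_fst.
have tc : continuous (fun z : realization R P * R => z.2 : R^o).
  by move=> z; exact: cvg_snd.
move=> z; apply: cvgB; apply: continuous_min; [exact: tc| |exact: tc|exact: sc].
by apply: cvgD; [exact: sc|exact: continuous_weight_fst].
Qed.

Lemma continuous_prism : continuous prism.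
Proof.
apply: continuous_realization => q z; apply: cvgD.
  apply: (@continuous_big R^o) z => [|p _ z]; first exact: add_continuous.
  apply: cvgB; [exact: continuous_weight_fst|exact: continuous_submerged].
apply: (@continuous_big R^o) z => [|p _]; first exact: add_continuous.
exact: continuous_submerged.
Qed.

(* The straight-line homotopy leaves the realization, as f q and g p need not be
   comparable when p < q; the prism only mixes f p with g q for p <= q. *)
Lemma realization_map_homotopic :
  homotopic R (realization_map R f) (realization_map R g).
Proof.
exists prism; split.
(* The submerged mass stays between 0 and [w p] for every real level, so [prism] is defined and
   continuous beyond the unit interval. *)
- exact/continuous_subspaceT/continuous_prism.
- move=> w; apply: realization_ext => q; rewrite /= /prism_weight.
  rewrite [X in _ + X]big1 ?addr0 => [|p _]; last exact/submerged0/set_valP.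
  by apply: eq_bigr => p _; rewrite submerged0 ?subr0 //; exact: set_valP.
- move=> w; apply: realization_ext => q; rewrite /= /prism_weight.
  rewrite [X in X + _]big1 ?add0r => [|p _].
    by apply: eq_bigr => p _; rewrite submerged1 //; exact: set_valP.
  by rewrite submerged1 ?subrr //; exact: set_valP.
Qed.

End Prism.

(** * From comparable composites to a homotopy equivalence *)

Lemma homotopic_ext (X Y : topologicalType) (f f' g g' : X -> Y) :
  f =1 f' -> g =1 g' -> homotopic R f g -> homotopic R f' g'.
Proof. by move=> /funext-> /funext->. Qed.

Lemma poset_homotopy_equiv_retract d d' (P : finPOrderType d)
    (Q : finPOrderType d') (f : {omorphism P -> Q}) (g : {omorphism Q -> P}) :
  cancel g f -> (forall p, g (f p) <= p)%O -> poset_homotopy_equiv R f.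
Proof.
move=> gK gf; exists g; split; try exact: realization_map_continuous.
- apply: homotopic_ext (realization_map_homotopic (f := g \o f) (g := idfun) gf).
    exact: realization_map_comp.
  exact: realization_map_idfun.
(* The equality is weakened to an inequality so that the prism homotopy applies here too. *)
- have fg q : ((f \o g) q <= idfun q)%O by rewrite /= gK.
  apply: homotopic_ext (realization_map_homotopic fg).
    exact: realization_map_comp.
  exact: realization_map_idfun.
Qed.

End Realization.

Theorem theorem1p6 (R : realType) (gT : finGroupType) :
  exists Phi : forall (P : left_poset gT) (T : right_graph gT) (G : graph),
      {omorphism eqposet P (hom_lposet T G) -> hom_complex (balprod T (skel P)) G},
    (forall (P : left_poset gT) (T : right_graph gT) (G : graph),
       poset_homotopy_equiv R (Phi P T G)) /\
    (forall (P P' : left_poset gT) (T T' : right_graph gT) (G G' : graph)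
            (a : left_poset_hom P' P) (k : right_graph_hom T' T) (h : graph_hom G G')
            (f : eqposet P (hom_lposet T G)),
       Phi P' T' G' (eqposet_map a k h f) =
       hom_map (bal_map k (skel_map a)) h (Phi P T G f)).
Proof.
exists (fun P T G => @to_hom gT P T G); split=> [P T G|]; last exact: to_hom_natural.
apply: (poset_homotopy_equiv_retract R (g := @of_hom gT P T G)).
  exact: of_homK.
exact: to_homK_le.
Qed.
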